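(* Let $\Gamma$ be a finite, simple, connected, regular graph with diameter $D$ and distinct adjacency eigenvalues $\lambda_0>\lambda_1>\cdots>\lambda_d$. Let $0\le h\le D$. Then $\Gamma$ is $h$-punctually distance-regular if and only if $\langle p_h(A),A_i\rangle=0$ for $i=0,\dots,h-1$ and $\langle p_i(A),A_h\rangle=0$ for $i=h+1,\dots,d$.
   Context: $A$ is the adjacency matrix of $\Gamma$, $n$ the number of vertices, $m_i$ the multiplicity of $\lambda_i$, $\partial(u,v)$ the distance. The distance-$i$ matrix $A_i$ ($0\le i\le D$) has $(A_i)_{uv}=1$ if $\partial(u,v)=i$ and $0$ otherwise. For symmetric matrices $R,S$, $\langle R,S\rangle=\frac1n\operatorname{tr}(RS)$. On the space $\mathbb{R}_d[x]$ of real polynomials of degree at most $d$, $\langle p,q\rangle=\frac1n\operatorname{tr}(p(A)q(A))=\frac1n\sum_{i=0}^d m_ip(\lambda_i)q(\lambda_i)$. The predistance polynomials $p_0,\dots,p_d$ are the unique polynomials with $\deg p_i=i$, $\langle p_i,p_j\rangle=0$ for $i\ne j$, and $\langle p_i,p_i\rangle=p_i(\lambda_0)$. $\Gamma$ is $h$-punctually distance-regular if $A_h=q_h(A)$ for some polynomial $q_h\in\mathbb{R}_d[x]$ with $\deg q_h=h$. *)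

(* Defs.v *)
From HB Require Import structures.
From mathcomp Require Import all_boot all_order all_algebra.
From mathcomp Require Import reals.

Set Implicit Arguments.
Unset Strict Implicit.
Unset Printing Implicit Defensive.

Import Order.TTheory GRing.Theory Num.Theory.
Local Open Scope ring_scope.

(* A finite simple graph is a symmetric irreflexive relation [e] on its
   vertices.  A connected graph has at least one vertex; its vertices are
   labelled by ['I_n.+1] (so that the number of vertices is n.+1), which is
   the form in which [horner_mx] evaluates polynomials at a square matrix. *)
Section Graph.

Variables (T : finType) (e : rel T).

Definition simple_graph : Prop := symmetric e /\ irreflexive e.

Definition connected_graph : Prop := forall u v, connect e u v.

Definition regular_graph : Prop :=
  exists k : nat, forall u, #|[set v | e u v]| = k.

(* The least length k of a path from u to v.  A shortest path has fewer than
   #|T| edges, so searching k < #|T| suffices; the value is the junk #|T|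
   when u and v are not connected. *)
Definition dist (u v : T) : nat :=
  find (fun k => [exists s : k.-tuple T, path e u s && (last u s == v)])
       (iota 0 #|T|).

Definition diameter : nat := (\max_(u : T) \max_(v : T) dist u v)%N.

End Graph.

Section Matrices.

Variables (R : realType) (n : nat).

Definition adjmx (e : rel 'I_n.+1) : 'M[R]_n.+1 :=
  \matrix_(u, v) (e u v)%:R.

Definition distmx (e : rel 'I_n.+1) (i : nat) : 'M[R]_n.+1 :=
  \matrix_(u, v) (dist e u v == i)%:R.

Definition mxdot (S S' : 'M[R]_n.+1) : R := (n.+1%:R)^-1 * \tr (S *m S').

Definition polydot (A : 'M[R]_n.+1) (p q : {poly R}) : R :=
  mxdot (horner_mx A p) (horner_mx A q).

(* lam_0 > lam_1 > ... > lam_d are all the distinct eigenvalues of A. *)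
Definition distinct_eigenvalues (A : 'M[R]_n.+1) (d : nat)
    (lam : 'I_d.+1 -> R) : Prop :=
  (forall i j : 'I_d.+1, (i < j)%N -> lam j < lam i) /\
  (forall x : R, eigenvalue A x <-> exists i, lam i = x).

(* Only the values p_0, ..., p_d of the sequence p are meaningful. *)
Definition predistance_polynomials (A : 'M[R]_n.+1) (d : nat)
    (lam : 'I_d.+1 -> R) (p : nat -> {poly R}) : Prop :=
  [/\ forall i, (i <= d)%N -> size (p i) = i.+1,
      forall i j, (i <= d)%N -> (j <= d)%N -> i != j ->
        polydot A (p i) (p j) = 0
    & forall i, (i <= d)%N -> polydot A (p i) (p i) = (p i).[lam ord0]].

Definition punctually_distance_regular (e : rel 'I_n.+1) (d h : nat) : Prop :=
  exists q : {poly R},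
    [/\ (size q <= d.+1)%N, size q = h.+1
      & distmx e h = horner_mx (adjmx e) q].

End Matrices.

Arguments adjmx R {n} e.
Arguments distmx R {n} e i.
Arguments punctually_distance_regular R {n} e d h.

(* Main.v *)
Require Import Defs.
From HB Require Import structures.
From mathcomp Require Import all_boot all_order all_algebra.
From mathcomp Require Import reals.
From mathcomp Require Import complex ring.

Set Implicit Arguments.
Unset Strict Implicit.
Unset Printing Implicit Defensive.

Import Order.TTheory GRing.Theory Num.Theory.
Local Open Scope ring_scope.

(* Since [(A^j)_uv = 0] for [j < dist u v], a polynomial in [A] of degree less
   than [h] is orthogonal to [A_h].  If [A_h = q(A)] with [q] of degree [h],
   then [q] is orthogonal to all polynomials of smaller degree, so it is a
   multiple of [p_h].  Conversely, let [S = p_h(A)] and let [J] be the all-ones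
   matrix.  As [J] is the sum of the [A_i], <S, A_h> = <S, J> = p_h(lam_0) =
   <S, S>.  By Hoffman's theorem [J = H(A)]; expanding [H] in the [p_i], of which
   only [p_h] is not orthogonal to [A_h], gives <A_h, A_h> = <J, A_h> = <S, S>.
   Hence [A_h - S] has norm 0. *)

(** * Polynomials in a real symmetric matrix and their eigenvectors *)

Section SymmetricMatrices.

Variables (R : rcfType) (n : nat).
Implicit Types (A : 'M[R]_n.+1) (q : {poly R}).

Lemma tr_horner_mx A q : A^T = A -> (horner_mx A q)^T = horner_mx A q.
Proof.
move=> A_sym; elim/poly_ind: q => [|q c IHq]; first by rewrite rmorph0 trmx0.
rewrite rmorphD rmorphM /= horner_mx_C horner_mx_X linearD /= tr_scalar_mx.
rewrite [_ * _ in LHS]/(_ *m _) trmx_mul IHq A_sym; congr (_ + _).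
exact/comm_mx_horner/comm_mx_refl.
Qed.

Lemma mulmx_horner_eigen A q (a : R) (v : 'rV_n.+1) :
  v *m A = a *: v -> v *m horner_mx A q = q.[a] *: v.
Proof.
move=> vA; elim/poly_ind: q => [|q c IHq].
  by rewrite rmorph0 horner0 mulmx0 scale0r.
rewrite rmorphD rmorphM /= horner_mx_C horner_mx_X hornerMXaddC.
rewrite [_ * A]/(_ *m _) mulmxDr mulmxA IHq -scalemxAl vA scalerA.
by rewrite mul_mx_scalar -scalerDl.
Qed.

(** Over the complex extension of [R] the spectral theorem makes [A] diagonal, so [q(A)] is
    conjugate to the diagonal matrix of the values of [q] at eigenvalues. *)
Lemma horner_symmetric_mx_eq0 A q : A^T = A ->
  (forall a, eigenvalue A a -> root q a) -> horner_mx A q = 0.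
Proof.
move=> A_sym rootq; pose f := real_complex R; pose M := map_mx f A.
have M_herm : M \is hermsymmx.
  apply: realsym_hermsym.
    apply/is_hermitianmxP; rewrite expr0 scale1r map_mx_id //.
    by rewrite /M map_trmx A_sym.
  by apply/mxOverP => i j; rewrite mxE; apply/complex_realP; exists (A i j).
have /hermitian_normalmx/orthomx_spectralP := M_herm.
set P := spectralmx M; set D := spectral_diag M => defM.
have Pu : P \in unitmx by exact: spectral_unit.
(* Row [j] of the invertible [P] is an eigenvector of [M] for the [j]-th diagonal entry. That entry
   is real, hence the image of an eigenvalue of [A]. *)
have D_root j : root (map_poly f q) (D 0 j).
  have /mxOverP/(_ 0 j)/complex_realP[x Dx] :=
    hermitian_spectral_diag_real M_herm.
  rewrite -/D in Dx; rewrite Dx fmorph_root; apply: rootq.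
  rewrite -(eigenvalue_map f) -/M; apply/eigenvalueP; exists (row j P).
    rewrite -row_mul defM -mulmxA mulKVmx // row_mul row_diag_mx Dx.
    by rewrite -scalemxAl -rowE.
  rewrite rowE; apply: contraTneq isT => /(congr1 (mulmx^~ (invmx P))).
  rewrite mul0mx mulmxK // => /rowP/(_ j)/eqP.
  by rewrite !mxE !eqxx oner_eq0.
apply: (map_mx_inj (f := f)); rewrite map_horner_mx -/M defM map_mx0.
rewrite horner_mx_uconjC // horner_mx_diag.
suff -> : map_mx (horner (map_poly f q)) D = 0.
  by rewrite raddf0 mulmx0 mul0mx.
by apply/rowP => j; rewrite !mxE; apply/rootP.
Qed.

Lemma root_horner_mx_eq0 A q a :
  horner_mx A q = 0 -> eigenvalue A a -> root q a.
Proof.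
move=> qA0; rewrite eigenvalue_root_min; apply: root_dvdp.
exact: mxminpoly_min.
Qed.

(** Both sides are twice the Laplacian quadratic form, with matrix [k I - A], at the eigenvector
    [x]. For [A] with nonnegative entries the left side is a sum of nonnegative terms. *)
Lemma laplacian_eigen A (k a : R) (x : 'rV_n.+1) : A^T = A ->
    (forall i, \sum_j A i j = k) -> x *m A = a *: x ->
  \sum_i \sum_j A i j * (x 0 i - x 0 j) ^+ 2
    = (k - a) * (\sum_i x 0 i ^+ 2) *+ 2.
Proof.
move=> A_sym rowA xA.
have Asw i j : A i j = A j i by rewrite -[in LHS]A_sym mxE.
have sq1 : \sum_i \sum_j A i j * x 0 i ^+ 2 = k * \sum_i x 0 i ^+ 2.
  by rewrite mulr_sumr; apply: eq_bigr => i _; rewrite -mulr_suml rowA.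
have sq2 : \sum_i \sum_j A i j * x 0 j ^+ 2 = k * \sum_i x 0 i ^+ 2.
  rewrite exchange_big -sq1; apply: eq_bigr => i _.
  by apply: eq_bigr => j _; rewrite Asw.
have cross : \sum_i \sum_j A i j * (x 0 i * x 0 j) = a * \sum_i x 0 i ^+ 2.
  rewrite exchange_big mulr_sumr; apply: eq_bigr => j _ /=.
  have /rowP/(_ j) := xA; rewrite !mxE => xAj.
  rewrite expr2 mulrA -xAj mulr_suml; apply: eq_bigr => i _.
  by rewrite mulrA [A i j * _]mulrC.
transitivity (\sum_i \sum_j (A i j * x 0 i ^+ 2 + A i j * x 0 j ^+ 2
                               - (A i j * (x 0 i * x 0 j)) *+ 2)).
  by apply: eq_bigr => i _; apply: eq_bigr => j _; ring.
under eq_bigr do rewrite sumrB big_split sumrMnl /=.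
by rewrite sumrB big_split sumrMnl /= sq1 sq2 cross; ring.
Qed.

End SymmetricMatrices.

(** * The trace form on matrices *)

Section Mxdot.

Variables (R : realType) (n : nat).
Implicit Types S T : 'M[R]_n.+1.

Lemma mxdotE S T :
  mxdot S T = n.+1%:R^-1 * \sum_i \sum_j S i j * T j i.
Proof. by congr (_ * _); apply: eq_bigr => i _; rewrite mxE. Qed.

Lemma mxdotC S T : mxdot S T = mxdot T S.
Proof. by rewrite /mxdot mxtrace_mulC. Qed.

Lemma mxdotZl a S T : mxdot (a *: S) T = a * mxdot S T.
Proof. by rewrite /mxdot -scalemxAl mxtraceZ mulrCA. Qed.

Lemma mxdotBl S1 S2 T : mxdot (S1 - S2) T = mxdot S1 T - mxdot S2 T.
Proof. by rewrite /mxdot mulmxBl raddfB mulrBr. Qed.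

Lemma mxdot_suml (I : Type) (r : seq I) (P : pred I) (F : I -> 'M[R]_n.+1) T :
  mxdot (\sum_(i <- r | P i) F i) T = \sum_(i <- r | P i) mxdot (F i) T.
Proof. by rewrite /mxdot mulmx_suml raddf_sum mulr_sumr. Qed.

(** For symmetric [S] the trace of [S *m S] is the sum of the squares of the entries. *)
Lemma mxdot_eq0 S : S^T = S -> mxdot S S = 0 -> S = 0.
Proof.
move=> S_sym /eqP; rewrite mxdotE mulf_eq0 invr_eq0 pnatr_eq0 /=.
have sq_ge0 i j : 0 <= S i j * S j i.
  by rewrite -[S in X in _ * X]S_sym mxE -expr2 sqr_ge0.
rewrite psumr_eq0 => [/allP S0|i _]; last by rewrite sumr_ge0.
apply/matrixP => i j; rewrite mxE.
have := S0 i (mem_index_enum i); rewrite psumr_eq0 // => /allP.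
move/(_ j (mem_index_enum j)).
by rewrite -[S in X in _ * X]S_sym mxE mulf_eq0 orbb => /eqP.
Qed.

End Mxdot.

(** * Distances read off from the powers of the adjacency matrix *)

Section Distance.

Variables (R : realType) (n : nat) (e : rel 'I_n.+1).
Local Notation A := (adjmx R e).

Lemma tr_adjmx : symmetric e -> A^T = A.
Proof. by move=> e_sym; apply/matrixP => u v; rewrite !mxE e_sym. Qed.

Lemma adjmx_exp_ge0 k u v : 0 <= (A ^+ k) u v.
Proof.
elim: k u v => [|k IHk] u v; first by rewrite mxE ler0n.
rewrite exprS -[_ * _]/(_ *m _) mxE sumr_ge0 // => w _.
by rewrite mulr_ge0 // mxE ler0n.
Qed.

(** All powers have nonnegative entries, so nothing cancels in the matrix product: an entry is
    nonzero exactly when some walk of length [k] contributes to it. *)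
Lemma adjmx_exp_neq0 k u v :
  ((A ^+ k) u v != 0)
    = [exists s : k.-tuple 'I_n.+1, path e u s && (last u s == v)].
Proof.
elim: k u => [|k IHk] u.
  rewrite mxE pnatr_eq0 eqb0 negbK; apply/idP/existsP => [uv|[s]].
    by exists [tuple]; rewrite /= uv.
  by rewrite tuple0.
rewrite exprS -[_ * _]/(_ *m _) mxE psumr_neq0; last first.
  by move=> w _; rewrite mulr_ge0 ?adjmx_exp_ge0 // mxE ler0n.
apply/hasP/existsP => [[w _ /=]|[s]].
  rewrite mxE; case: (boolP (e u w)) => [euw|_]; last by rewrite mul0r ltxx.
  rewrite mul1r => /lt0r_neq0; rewrite IHk => /existsP[s /andP[ps lsv]].
  by exists [tuple of w :: s]; rewrite /= euw ps.
case/tupleP: s => w s /= /andP[/andP[euw ps] lsv].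
exists w; first exact: mem_index_enum.
rewrite mxE euw mul1r lt0r adjmx_exp_ge0 IHk andbT.
by apply/existsP; exists s; rewrite ps.
Qed.

Lemma distE u v : dist e u v = find (fun k => (A ^+ k) u v != 0) (iota 0 n.+1).
Proof.
by rewrite /dist card_ord; apply: eq_find => k; rewrite adjmx_exp_neq0.
Qed.

Lemma dist_leq u v : (dist e u v <= n.+1)%N.
Proof. by rewrite distE -[X in (_ <= X)%N](size_iota 0) find_size. Qed.

(** By [distE] the distance is the first exponent whose power is nonzero at [u], [v]; all powers of
    [A] occurring in [q(A)] are smaller. *)
Lemma horner_adjmx_lt_dist (q : {poly R}) u v :
  (size q <= dist e u v)%N -> horner_mx A q u v = 0.
Proof.
move=> le_q; rewrite -[q]coefK poly_def linear_sum summxE big1 // => i _.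
rewrite linearZ rmorphXn /= horner_mx_X mxE.
have lt_i : (i < dist e u v)%N by exact: leq_trans le_q.
have := before_find 0%N (etrans (congr1 (leq i.+1) (esym (distE u v))) lt_i).
rewrite nth_iota ?(leq_trans lt_i) ?dist_leq // add0n => /negbFE/eqP->.
by rewrite mulr0.
Qed.

(** A walk shortened to a path without repeated vertices has at most [n] edges, so the search in
    [distE] succeeds and does not return its default [n.+1]. *)
Lemma adjmx_exp_dist u v :
  connect e u v -> (A ^+ dist e u v) u v != 0.
Proof.
case/connectP => s /shortenP[s' ps' us' _ ->] {s}.
set w := last u s'.
have lt_s' : (size s' < n.+1)%N.
  by have := max_card (mem (u :: s')); rewrite (card_uniqP us') card_ord.
have has_walk : has (fun k => (A ^+ k) u w != 0) (iota 0 n.+1).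
  apply/hasP; exists (size s'); first by rewrite mem_iota.
  rewrite adjmx_exp_neq0; apply/existsP; exists (in_tuple s').
  by rewrite ps' eqxx.
have := nth_find 0%N has_walk; rewrite nth_iota -?distE //.
by rewrite distE -[X in (_ < X)%N](size_iota 0) -has_find.
Qed.

(** The range includes [n.+1], the default value of [dist], so that each pair of vertices is counted
    exactly once. *)
Lemma distmx_sum : \sum_(i < n.+2) distmx R e i = const_mx 1.
Proof.
apply/matrixP => u v; rewrite summxE mxE.
rewrite (bigD1 (Ordinal (dist_leq u v : dist e u v < n.+2)%N)) //= mxE eqxx.
rewrite big1 ?addr0 // => i; rewrite mxE eq_sym -val_eqE /=.
by move/negPf->.
Qed.

Lemma sum_adjmx k u : #|[set v | e u v]| = k -> \sum_v A u v = k%:R.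
Proof.
move=> <-; rewrite cardsE -sum1_card natr_sum [RHS]big_mkcond /=.
by apply: eq_bigr => v _; rewrite mxE unfold_in; case: (e u v).
Qed.

Hypothesis e_sym : symmetric e.

Lemma dist_sym u v : dist e u v = dist e v u.
Proof.
rewrite !distE; apply: eq_find => k; congr (_ != 0).
have := tr_horner_mx 'X^k (tr_adjmx e_sym).
by rewrite rmorphXn /= horner_mx_X => /matrixP/(_ v u); rewrite mxE.
Qed.

Lemma tr_distmx h : (distmx R e h)^T = distmx R e h.
Proof. by apply/matrixP => u v; rewrite !mxE dist_sym. Qed.

Lemma mxdot_distmx i j : i != j -> mxdot (distmx R e i) (distmx R e j) = 0.
Proof.
move=> neq_ij; rewrite mxdotE big1 ?mulr0 // => u _; rewrite big1 // => v _.
rewrite !mxE [dist e v u]dist_sym; case: eqP => [->|_]; last by rewrite mul0r.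
by rewrite (negPf neq_ij) mulr0.
Qed.

(** The supports are disjoint: [q(A)] vanishes at every pair at distance [i], and [distmx] vanishes
    at all others. *)
Lemma mxdot_horner_distmx (q : {poly R}) i :
  (size q <= i)%N -> mxdot (horner_mx A q) (distmx R e i) = 0.
Proof.
move=> le_q; rewrite mxdotE big1 ?mulr0 // => u _; rewrite big1 // => v _.
rewrite [distmx _ _ _ _ _]mxE dist_sym; case: eqP => [uvi|_].
  by rewrite horner_adjmx_lt_dist ?mul0r // uvi.
by rewrite mulr0.
Qed.

Lemma mxdot_distmx_const1 h :
  mxdot (const_mx 1) (distmx R e h) = mxdot (distmx R e h) (distmx R e h).
Proof.
rewrite !mxdotE; congr (_ * _); apply: eq_bigr => u _; apply: eq_bigr => v _.
by rewrite !mxE mul1r dist_sym -natrM mulnb andbb.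
Qed.

End Distance.

(** * The scalar product on polynomials of degree at most [d] *)

Section DistinctEigenvalues.

Variables (R : realType) (n : nat) (A : 'M[R]_n.+1).
Variables (d : nat) (lam : 'I_d.+1 -> R).
Hypotheses (A_sym : A^T = A) (lam_spec : distinct_eigenvalues A lam).

Lemma distinct_eigenvalues_inj : injective lam.
Proof.
case: lam_spec => lam_dec _ i j eq_ij.
by case: (ltngtP i j) => [/lam_dec|/lam_dec|/val_inj]; rewrite // eq_ij ltxx.
Qed.

Lemma horner_mx_prod_eigenvalues :
  horner_mx A (\prod_i ('X - (lam i)%:P)) = 0.
Proof.
apply: horner_symmetric_mx_eq0 => // a /lam_spec.2[i <-].
by rewrite /root horner_prod (bigD1 i) //= hornerXsubC subrr mul0r.
Qed.

(** Definiteness of the form: norm 0 gives [q(A) = 0], and then [q] has the [d.+1] distinct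
    eigenvalues as roots, too many for its degree. *)
Lemma polydot_eq0 (q : {poly R}) :
  (size q <= d.+1)%N -> polydot A q q = 0 -> q = 0.
Proof.
move=> le_q /(mxdot_eq0 (tr_horner_mx q A_sym)) qA0; apply/eqP.
apply: contraTT le_q => q_neq0; rewrite -ltnNge.
have -> : d.+1 = size (codom lam) by rewrite size_codom card_ord.
apply: max_poly_roots => //.
  apply/allP => _ /codomP[i ->]; apply: root_horner_mx_eq0 qA0 _.
  by apply/lam_spec.2; exists i.
by rewrite map_inj_uniq ?enum_uniq //; apply: distinct_eigenvalues_inj.
Qed.

Variable p : nat -> {poly R}.
Hypothesis p_predist : predistance_polynomials A lam p.

Lemma polydot_predist_neq0 i : (i <= d)%N -> polydot A (p i) (p i) != 0.
Proof.
case: p_predist => sz_p _ _ le_id; apply/eqP => /polydot_eq0.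
by rewrite sz_p // ltnS => /(_ le_id)/eqP; rewrite -size_poly_eq0 sz_p.
Qed.

(** Pairing with [p j] extracts the coefficient [c j]. The bound [m] allows expansions up to degree
    [h] as well as up to degree [d]. *)
Lemma polydot_predist_sum (c : nat -> R) m j : (m <= d.+1)%N -> (j <= d)%N ->
  polydot A (\sum_(i < m) c i *: p i) (p j)
    = if (j < m)%N then c j * polydot A (p j) (p j) else 0.
Proof.
case: p_predist => _ orth _ le_md le_jd.
rewrite /polydot linear_sum mxdot_suml.
have term (i : 'I_m) : mxdot (horner_mx A (c i *: p i)) (horner_mx A (p j))
    = c i * polydot A (p i) (p j) by rewrite linearZ mxdotZl.
under eq_bigr do rewrite term.
case: ifP => [lt_jm|ge_jm].
  rewrite (bigD1 (Ordinal lt_jm)) //= big1 ?addr0 // => i; rewrite -val_eqE /=.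
  by move=> ij; rewrite orth ?mulr0 // -ltnS (leq_trans (ltn_ord i)).
rewrite big1 // => i _; rewrite orth ?mulr0 //.
  by rewrite -ltnS (leq_trans (ltn_ord i)).
by apply: contraFneq ge_jm => <-.
Qed.

End DistinctEigenvalues.

Lemma graded_poly_span (F : fieldType) (p : nat -> {poly F}) m (q : {poly F}) :
    (forall i, (i < m)%N -> size (p i) = i.+1) -> (size q <= m)%N ->
  exists c : nat -> F, q = \sum_(i < m) c i *: p i.
Proof.
elim: m q => [|m IHm] q sz_p le_q.
  by exists (fun=> 0); apply/eqP; rewrite big_ord0 -size_poly_leq0.
(* Subtracting [a *: p m] cancels the coefficient of degree [m]. *)
pose a := q`_m / lead_coef (p m).
have pm_neq0 : p m != 0 by rewrite -size_poly_eq0 sz_p.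
have [i lt_im|//|c def_c] := IHm (q - a *: p m).
- by rewrite sz_p // ltnW.
- apply/leq_sizeP => j; rewrite leq_eqVlt coefB coefZ => /predU1P[<-|lt_mj].
    have -> : (p m)`_m = lead_coef (p m) by rewrite lead_coefE sz_p.
    by rewrite divfK ?subrr // lead_coef_eq0.
  by rewrite !nth_default ?sz_p // ?(leq_trans le_q) // mulr0 subr0.
exists (fun i => if i == m then a else c i); rewrite big_ord_recr /= eqxx.
rewrite -[q](subrK (a *: p m)) def_c; congr (_ + _).
by apply: eq_bigr => i _; rewrite ltn_eqF.
Qed.

(** * Spectrum of a connected regular graph and Hoffman's polynomial *)

Section RegularGraph.

Variables (R : realType) (n : nat) (e : rel 'I_n.+1).
Local Notation A := (adjmx R e).
Hypotheses (e_sym : symmetric e) (e_conn : connected_graph e).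
Variable k : nat.
Hypothesis e_reg : forall u, #|[set v | e u v]| = k.

Lemma const1_adjmx : const_mx 1 *m A = k%:R *: const_mx 1 :> 'rV_n.+1.
Proof.
apply/rowP => v; rewrite !mxE mulr1 -(sum_adjmx R (e_reg v)).
by apply: eq_bigr => u _; rewrite !mxE mul1r e_sym.
Qed.

Lemma eigenvalue_adjmx_degree : eigenvalue A k%:R.
Proof.
apply/eigenvalueP; exists (const_mx 1); first exact: const1_adjmx.
by apply/eqP => /rowP/(_ ord0)/eqP; rewrite !mxE oner_eq0.
Qed.

(** The left side of [laplacian_eigen] is nonnegative and the squared norm of an eigenvector is
    positive, so [k - a] is nonnegative. *)
Lemma eigenvalue_adjmx_le a : eigenvalue A a -> a <= k%:R.
Proof.
case/eigenvalueP => x xA x_neq0; rewrite -subr_ge0.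
have x2_gt0 : 0 < \sum_i x 0 i ^+ 2.
  have [i xi] : exists i, x 0 i != 0.
    by apply/rV0Pn.
  rewrite (bigD1 i) //= ltr_wpDr ?sumr_ge0 // => [j _|]; first exact: sqr_ge0.
  by rewrite exprn_even_gt0.
rewrite -(pmulr_lge0 _ x2_gt0) -(pmulrn_lge0 _ (ltn0Sn 1)).
rewrite -(laplacian_eigen (tr_adjmx R e_sym) _ xA); last first.
  by move=> i; exact: sum_adjmx.
rewrite sumr_ge0 // => i _; rewrite sumr_ge0 // => j _.
by rewrite mulr_ge0 ?sqr_ge0 // mxE ler0n.
Qed.

(** For the eigenvalue [k] the Laplacian sum is 0, so each term is: [x] agrees at the ends of every
    edge, hence along every path. *)
Lemma adjmx_degree_eigenvector (x : 'rV[R]_n.+1) u v :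
  x *m A = k%:R *: x -> x 0 u = x 0 v.
Proof.
move=> xA.
have := laplacian_eigen (tr_adjmx R e_sym) (fun i => sum_adjmx R (e_reg i)) xA.
have ge0 i j : 0 <= A i j * (x 0 i - x 0 j) ^+ 2.
  by rewrite mulr_ge0 ?sqr_ge0 // mxE ler0n.
rewrite subrr mul0r mul0rn => /eqP.
rewrite psumr_eq0 => [/allP lap0|i _]; last by rewrite sumr_ge0.
have edge i j : e i j -> x 0 i = x 0 j.
  move=> eij; have := lap0 i (mem_index_enum i).
  rewrite psumr_eq0 // => /allP/(_ j (mem_index_enum j)) /=.
  by rewrite mxE eij mul1r sqrf_eq0 subr_eq0 => /eqP.
have /connectP[s] := e_conn u v.
by elim: s u => [|w s IHs] u /= => [_ ->|/andP[/edge-> ps] /(IHs _ ps)].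
Qed.

Variables (d : nat) (lam : 'I_d.+1 -> R).
Hypothesis lam_spec : distinct_eigenvalues A lam.

Lemma max_eigenvalue_adjmx : lam ord0 = k%:R.
Proof.
have [lam_dec eigA] := lam_spec; apply/le_anti/andP; split.
  by apply/eigenvalue_adjmx_le/eigA; exists ord0.
have [i <-] := (eigA _).1 eigenvalue_adjmx_degree.
have [->//|i_neq0] := eqVneq i ord0.
by rewrite ltW // lam_dec // lt0n.
Qed.

(** The all-ones vector is an eigenvector for [lam ord0], so each column of [q(A)] sums to the value
    of [q] there. *)
Lemma mxdot_horner_const1 (q : {poly R}) :
  mxdot (horner_mx A q) (const_mx 1) = q.[lam ord0].
Proof.
have := mulmx_horner_eigen q const1_adjmx; rewrite -max_eigenvalue_adjmx.
set S := horner_mx A q => /rowP colS.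
have colS1 j : \sum_i S i j = q.[lam ord0].
  have := colS j; rewrite !mxE mulr1 => <-.
  by apply: eq_bigr => i _; rewrite mxE mul1r.
rewrite mxdotE exchange_big /=.
have -> : \sum_(j < n.+1) \sum_(i < n.+1) S i j * const_mx 1 j i
    = \sum_(j < n.+1) q.[lam ord0].
  apply: eq_bigr => j _; rewrite -(colS1 j).
  by apply: eq_bigr => i _; rewrite mxE mulr1.
by rewrite sumr_const card_ord -[X in _ * X]mulr_natl mulKf ?pnatr_eq0.
Qed.

(* The product of the ['X - lam i] with [i > 0] sends [A] to a matrix all of
   whose rows are eigenvectors for the degree, hence constant. *)
Lemma hoffman_poly :
  exists2 H : {poly R}, (size H <= d.+1)%N & horner_mx A H = const_mx 1.
Proof.
pose H0 : {poly R} := \prod_(i < d) ('X - (lam (lift ord0 i))%:P).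
pose B := horner_mx A H0.
have BA : B *m A = k%:R *: B.
  have := horner_mx_prod_eigenvalues (tr_adjmx R e_sym) lam_spec.
  rewrite big_ord_recl -/H0 mulrC rmorphM rmorphB /= horner_mx_C horner_mx_X.
  rewrite -/B max_eigenvalue_adjmx mulrBr -!mulmxE mul_mx_scalar.
  by move/eqP; rewrite subr_eq0 => /eqP.
have B_row u v w : B u v = B u w.
  have := @adjmx_degree_eigenvector (row u B) v w; rewrite -row_mul BA.
  by rewrite linearZ !mxE; apply.
have B_sym u v : B u v = B v u.
  by have /matrixP/(_ v u) := tr_horner_mx H0 (tr_adjmx R e_sym); rewrite mxE.
have BE : B = B 0 0 *: const_mx 1.
  by apply/matrixP => u v; rewrite !mxE mulr1 (B_row u v 0) B_sym; apply: B_row.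
(* If this entry were 0, then so would be [B] and its product with the all-ones matrix; but that
   product is the value of [H0] at [lam ord0], which is not a root of [H0]. *)
have B00 : B 0 0 != 0.
  apply/eqP => B0; rewrite B0 scale0r in BE.
  have := mxdot_horner_const1 H0; rewrite -/B BE /mxdot mul0mx mxtrace0 mulr0.
  move/esym/eqP; rewrite horner_prod; apply/negP/prodf_neq0 => i _.
  rewrite hornerXsubC subr_eq0 (inj_eq (distinct_eigenvalues_inj lam_spec)).
  exact: neq_lift.
exists ((B 0 0)^-1 *: H0); last first.
  by rewrite linearZ /= -/B [X in _ *: X]BE scalerA mulVf // scale1r.
rewrite (leq_trans (size_scale_leq _ _)) // size_prod_XsubC.
by rewrite [index_enum _]unlock -enumT size_enum_ord.
Qed.

(** If [u] and [v] were at distance [m > d], reducing ['X^m] modulo the product [P], which kills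
    [A], would write [A ^+ m] as a polynomial in [A] of degree at most [d]. That polynomial vanishes
    at [u], [v], while [A ^+ m] does not. *)
Lemma diameter_leq : (diameter e <= d)%N.
Proof.
apply/bigmax_leqP => u _; apply/bigmax_leqP => v _; rewrite leqNgt.
apply: contra (adjmx_exp_dist R (e_conn u v)) => lt_d.
set m := dist e u v in lt_d *.
pose P := \prod_i ('X - (lam i)%:P).
have sizeP : size P = d.+2.
  by rewrite size_prod_XsubC [index_enum _]unlock -enumT size_enum_ord.
have -> : A ^+ m = horner_mx A ('X^m %% P).
  rewrite -[in LHS](horner_mx_X A) -rmorphXn /= [in LHS](divp_eq 'X^m P).
  rewrite rmorphD rmorphM /= [horner_mx A P]horner_mx_prod_eigenvalues //.
    by rewrite mulr0 add0r.
  exact: tr_adjmx.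
rewrite horner_adjmx_lt_dist // -/m (leq_trans _ lt_d) // -ltnS -sizeP.
by rewrite ltn_modp -size_poly_eq0 sizeP.
Qed.

End RegularGraph.

(** * The characterization of punctual distance-regularity *)

Theorem corollary4p5 (R : realType) (n : nat) (e : rel 'I_n.+1)
    (e_simple : simple_graph e) (e_conn : connected_graph e)
    (e_reg : regular_graph e)
    (d : nat) (lam : 'I_d.+1 -> R)
    (lam_spec : distinct_eigenvalues (adjmx R e) lam)
    (p : nat -> {poly R})
    (p_predist : predistance_polynomials (adjmx R e) lam p)
    (h : nat) (h_le_D : (h <= diameter e)%N) :
  punctually_distance_regular R e d h <->
  (forall i : nat, (i < h)%N ->
     mxdot (horner_mx (adjmx R e) (p h)) (distmx R e i) = 0) /\
  (forall i : nat, (h < i <= d)%N ->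
     mxdot (horner_mx (adjmx R e) (p i)) (distmx R e h) = 0).
Proof.
have [e_sym _] := e_simple; have [k k_reg] := e_reg.
have A_sym := tr_adjmx R e_sym.
have [sz_p _ norm_p] := p_predist.
have h_le_d : (h <= d)%N.
  exact: leq_trans h_le_D (diameter_leq e_sym e_conn lam_spec).
split=> [[q [_ sz_q Ah]]|[Sorth Ahorth]].
  have [||c def_q] := @graded_poly_span _ p h.+1 q; rewrite ?sz_q //.
    by move=> i lt_i; rewrite sz_p // (leq_trans _ h_le_d).
  have dot_q j : (j <= d)%N ->
      polydot (adjmx R e) q (p j)
        = mxdot (horner_mx (adjmx R e) (p j)) (distmx R e h).
    by rewrite /polydot -Ah mxdotC.
  (* Pairing [q] with [p j] gives [c j] times a nonzero norm on one side, and on the other 0, since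
     [p j] has degree below [h]. *)
  have c0 j : (j < h)%N -> c j = 0.
    move=> lt_jh; have le_jd := leq_trans (ltnW lt_jh) h_le_d.
    have := dot_q j le_jd; rewrite mxdot_horner_distmx ?sz_p //.
    rewrite def_q (polydot_predist_sum p_predist) // ltnS (ltnW lt_jh) => /eqP.
    have /negPf pj_neq0 := polydot_predist_neq0 A_sym lam_spec p_predist le_jd.
    by rewrite mulf_eq0 pj_neq0 orbF => /eqP.
  have qE : q = c h *: p h.
    rewrite def_q big_ord_recr /= big1 ?add0r // => i _.
    by rewrite c0 ?scale0r.
  have ch_neq0 : c h != 0.
    by apply: contra_eq_neq sz_q => ch0; rewrite qE ch0 scale0r size_poly0.
  split=> i.
    move=> lt_ih; apply: (mulfI ch_neq0); rewrite mulr0 -mxdotZl -linearZ /= -qE.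
    by rewrite -Ah mxdot_distmx // gtn_eqF.
  (* The expansion of [q] stops at [p h], so [q] is orthogonal to [p i]. *)
  case/andP=> lt_hi le_id; rewrite -dot_q // def_q.
  by rewrite (polydot_predist_sum p_predist) // ltnS leqNgt lt_hi.
exists (p h); split; rewrite ?sz_p //.
set S := horner_mx _ (p h); set Ah := distmx R e h.
have SJ : mxdot S (const_mx 1) = mxdot S S.
  by rewrite (mxdot_horner_const1 e_sym k_reg lam_spec) -norm_p.
have SAh : mxdot S Ah = mxdot S S.
  (* This makes [h] an index of the sum in [distmx_sum]. *)
  have h_lt : (h < n.+2)%N.
    rewrite ltnS (leq_trans h_le_D) //; apply/bigmax_leqP => u _.
    by apply/bigmax_leqP => v _; apply: dist_leq.
  rewrite -SJ -(distmx_sum R e) [RHS]mxdotC mxdot_suml.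
  rewrite (bigD1 (Ordinal h_lt)) //=.
  rewrite big1 ?addr0 => [|i]; first exact: mxdotC.
  (* The terms with [i < h] vanish by assumption, those with [i > h] because [p h] has degree
     [h]. *)
  rewrite -val_eqE /= mxdotC neq_ltn => /orP[/Sorth //|lt_hi].
  by rewrite mxdot_horner_distmx // sz_p.
have [H sz_H HA] := hoffman_poly e_sym e_conn k_reg lam_spec.
have [||c def_H] := @graded_poly_span _ p d.+1 H; rewrite ?sz_H //.
have AhAh : mxdot Ah Ah = c h * mxdot S S.
  rewrite -mxdot_distmx_const1 // -HA def_H linear_sum mxdot_suml.
  rewrite (bigD1 (Ordinal (h_le_d : (h < d.+1)%N))) //= linearZ mxdotZl.
  rewrite -/S SAh big1 ?addr0 // => i; rewrite -val_eqE /= linearZ mxdotZl.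
  rewrite neq_ltn => /orP[lt_ih|lt_hi].
    by rewrite mxdot_horner_distmx ?mulr0 // sz_p // -ltnS.
  by rewrite Ahorth ?mulr0 // lt_hi leq_ord.
(* The norm of [S] is also its product with the all-ones matrix [H(A)], which extracts [c h]. With
   [AhAh], this gives [Ah] and [S] the same norm. *)
have SS : mxdot S S = c h * mxdot S S.
  rewrite -[LHS]SJ mxdotC -HA -[LHS]/(polydot _ H (p h)) def_H.
  by rewrite (polydot_predist_sum p_predist) // ltnS h_le_d.
apply: subr0_eq; apply: mxdot_eq0.
  by rewrite linearB /= tr_distmx // tr_horner_mx.
rewrite mxdotBl ![mxdot _ (Ah - S)]mxdotC !mxdotBl SAh AhAh.
by rewrite [mxdot Ah S]mxdotC SAh -SS subrr.
Qed.
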